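(* Let $F_1,\dots,F_4$ be linear forms in $x,y,z$ and $F_5,\dots,F_8$ linear forms in $y,z,t$ over $\mathbb{C}$ such that the eight planes $F_1=0,\dots,F_8=0$ in $\mathbb{P}^3$ (coordinates $(x:y:z:t)$) form an octic arrangement with $\bigcap_{i=1}^{4}\{F_i=0\}=\{(0:0:0:1)\}$ and $\bigcap_{i=5}^{8}\{F_i=0\}=\{(1:0:0:0)\}$. Then the double octic Calabi–Yau threefold $$u^{2}=F_{1}(x,y,z)\cdots F_{4}(x,y,z)\, F_{5}(y,z,t)\cdots F_{8}(y,z,t)$$ is birational to the Kummer fibration $(S_1\times_{\mathbb{P}^1}S_2)/(i_1\times i_2)$ of the elliptic surfaces $$S_1:\ v_{1}^{2}=F_{1}(x,y,z)\cdots F_{4}(x,y,z) \quad\text{ and }\quad S_2:\ v_{2}^{2}=F_{5}(y,z,t)\cdots F_{8}(y,z,t).$$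
   Context: An octic arrangement is a union $D=P_1\cup\dots\cup P_8$ of eight distinct planes in $\mathbb{P}^3=\mathbb{P}^3_{\mathbb{C}}$ such that no six of the planes meet in a point and no four contain a common line. If $P_i$ has equation $\ell_i(x,y,z,t)=0$, the double octic defined by $D$ is a Calabi–Yau threefold obtained as a crepant resolution of the double cover of $\mathbb{P}^3$ branched along $D$, i.e. of the hypersurface $u^2=\ell_1\cdots \ell_8$ in the weighted projective space $\mathbb{P}(1,1,1,1,4)$; for birational questions it can be replaced by this hypersurface. $S_1$ and $S_2$ are (up to birational equivalence) the double covers of the projective planes with coordinates $(x:y:z)$ and $(y:z:t)$ given by the displayed equations (in $\mathbb{P}(1,1,1,2)$), each fibred by genus one curves over $\mathbb{P}^1$ via the rational map to $(y:z)$. The fibrewise elliptic involutions are $i_1:(x,y,z,v_1)\mapsto(x,y,z,-v_1)$ on $S_1$ and $i_2:(y,z,t,v_2)\mapsto(y,z,t,-v_2)$ on $S_2$. The Kummer fibration is the quotient of the fibre product $S_1\times_{\mathbb{P}^1}S_2$ (over $\mathbb{P}^1$ with coordinates $(y:z)$) by the involution $i_1\times i_2$. *)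

(* Defs.v *)
From mathcomp Require Import all_boot all_order all_algebra.
From mathcomp Require Import classical_sets mpoly.

Set Implicit Arguments.
Unset Strict Implicit.
Unset Printing Implicit Defensive.

Import GRing.Theory.
Local Open Scope ring_scope.
Local Open Scope classical_set_scope.

(** * Spaces with functions, presented as quotients

  Varieties are handled in Serre's language, as topological spaces with a
  sheaf of K-valued functions.  A [qspace] is the quotient of a subset [pts] of
  affine space by an equivalence relation [eqv] (only the restriction of [eqv]
  to [pts] matters), with the quotient topology of the Zariski topology and
  the quotient sheaf: a function on an open set of the quotient is regular iff
  its pullback to [pts] is.  Subsets of the quotient are represented by
  saturated subsets of [pts], functions on it by invariant functions, and maps
  between quotients by maps compatible with the relations. *)

Record qspace (K : fieldType) := QSpace {
  ambdim : nat;
  pts : set 'rV[K]_ambdim;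
  eqv : 'rV[K]_ambdim -> 'rV[K]_ambdim -> Prop
}.

Section Spaces.
Variable K : fieldType.
Implicit Types X Y B : qspace K.

Definition peval n (p : {mpoly K[n]}) (v : 'rV[K]_n) : K :=
  p.@[fun i => v 0 i].

Definition zariski_open n (W : set 'rV[K]_n) : Prop :=
  exists S : set {mpoly K[n]},
    W = [set v | exists2 p, S p & peval p v != 0].

Definition is_open X (U : set 'rV[K]_(ambdim X)) : Prop :=
  (forall x y, U x -> pts y -> eqv x y -> U y) /\
  exists2 W, zariski_open W & U = @pts K X `&` W.

Definition is_dense X (U : set 'rV[K]_(ambdim X)) : Prop :=
  forall W, is_open W -> W !=set0 -> (U `&` W) !=set0.

(* Neighbourhoods are omitted in the local condition: if h = p / q on the
   neighbourhood of v where a polynomial g does not vanish, then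
   h = (p * g) / (q * g) wherever the new denominator does not vanish. *)
Definition is_regular X (U : set 'rV[K]_(ambdim X))
    (h : 'rV[K]_(ambdim X) -> K) :=
  (forall x y, U x -> U y -> eqv x y -> h x = h y) /\
  forall v, U v -> exists p q : {mpoly K[ambdim X]},
    peval q v != 0 /\
    forall w, U w -> peval q w != 0 -> h w = peval p w / peval q w.

Definition is_morphism X Y
    (U : set 'rV[K]_(ambdim X)) (V : set 'rV[K]_(ambdim Y))
    (f : 'rV[K]_(ambdim X) -> 'rV[K]_(ambdim Y)) : Prop :=
  [/\ forall x, U x -> V (f x),
      forall x y, U x -> U y -> eqv x y -> eqv (f x) (f y),
      forall W, is_open W -> W `<=` V -> is_open (U `&` f @^-1` W)
    & forall W h, is_open W -> W `<=` V -> is_regular W h ->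
        is_regular (U `&` f @^-1` W) (h \o f)].

Definition birational X Y : Prop :=
  exists (U : set 'rV[K]_(ambdim X)) (V : set 'rV[K]_(ambdim Y)) f g,
    [/\ is_open U /\ is_dense U, is_open V /\ is_dense V,
        is_morphism U V f, is_morphism V U g
      & (forall x, U x -> eqv (g (f x)) x) /\
        (forall y, V y -> eqv (f (g y)) y)].

(** * Constructions *)

Definition qsubspace X (A : set 'rV[K]_(ambdim X)) : qspace K :=
  QSpace (@pts K X `&` A) (@eqv K X).

Definition product X Y : qspace K :=
  QSpace
    [set p : 'rV[K]_(ambdim X + ambdim Y) | pts (lsubmx p) /\ pts (rsubmx p)]
    (fun p q => eqv (lsubmx p) (lsubmx q) /\ eqv (rsubmx p) (rsubmx q)).

(* Fibre product over B of rational maps X --> B and Y --> B, given in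
   coordinates by f and g and defined where these take values in [pts B];
   it is formed over the domains of definition. *)
Definition fiber_product X Y B
    (f : 'rV[K]_(ambdim X) -> 'rV[K]_(ambdim B))
    (g : 'rV[K]_(ambdim Y) -> 'rV[K]_(ambdim B)) : qspace K :=
  @qsubspace (product X Y)
    [set p | [/\ pts (f (lsubmx p)), pts (g (rsubmx p))
               & eqv (f (lsubmx p)) (g (rsubmx p))]].

Definition involution_quotient X
    (iota : 'rV[K]_(ambdim X) -> 'rV[K]_(ambdim X)) : qspace K :=
  QSpace (@pts K X) (fun p q => eqv p q \/ eqv (iota p) q).

Definition weighted_proj n (w : 'I_n -> nat) : qspace K :=
  QSpace [set v : 'rV[K]_n | v != 0]
    (fun u v => exists2 c : K, c != 0 & v = \row_i (c ^+ w i * u 0 i)).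

Definition proj n : qspace K := @weighted_proj n.+1 (fun=> 1%N).

(* A linear form is given by the column of its coefficients. *)
Definition lform n (l : 'cV[K]_n) (v : 'rV[K]_n) : K := (v *m l) 0 0.

(* The double cover s ^ 2 = L_1 ... L_k of the projective space with n
   homogeneous coordinates, in P(1, ..., 1, k/2), for k even; the last
   coordinate is s. *)
Definition double_cover n k (L : 'I_k -> 'cV[K]_n) : qspace K :=
  @qsubspace (weighted_proj (fun i : 'I_(n + 1) => if i < n then 1 else k./2)%N)
    [set p : 'rV[K]_(n + 1) |
       rsubmx p 0 0 ^+ 2 = \prod_(i < k) lform (L i) (lsubmx p)].

Definition sheet_swap n (p : 'rV[K]_(n + 1)) : 'rV[K]_(n + 1) :=
  row_mx (lsubmx p) (- rsubmx p).

(** * Octic arrangements *)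

Definition octic_arrangement (l : 'I_8 -> 'cV[K]_4) : Prop :=
  [/\ forall i, l i != 0,
      forall i j,
        (forall v, lform (l i) v = 0 <-> lform (l j) v = 0) -> i = j,
      forall (S : {set 'I_8}) (v : 'rV[K]_4), #|S| = 6%N -> v != 0 ->
        ~ (forall i, i \in S -> lform (l i) v = 0)
    & (* lines of P^3 are the row spaces of 2 x 4 matrices of rank 2 *)
      forall (S : {set 'I_8}) (A : 'M[K]_(2, 4)), #|S| = 4%N -> row_free A ->
        ~ (forall i, i \in S -> A *m l i = 0)].

(* Forms in (x, y, z), resp. (y, z, t), as forms in (x, y, z, t). *)
Definition form_xyz (a : 'cV[K]_3) : 'cV[K]_4 := col_mx a (0 : 'cV_1).
Definition form_yzt (a : 'cV[K]_3) : 'cV[K]_4 := col_mx (0 : 'cV_1) a.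

Definition eight_forms (F G : 'I_4 -> 'cV[K]_3) (i : 'I_8) : 'cV[K]_4 :=
  match split (i : 'I_(4 + 4)) with
  | inl j => form_xyz (F j)
  | inr j => form_yzt (G j)
  end.

Definition double_octic (l : 'I_8 -> 'cV[K]_4) : qspace K := double_cover l.

(** * The Kummer fibration *)

Definition quartic_double_plane (F : 'I_4 -> 'cV[K]_3) : qspace K :=
  double_cover F.

(* (x, y, z, v1) |-> (y, z) and (y, z, t, v2) |-> (y, z). *)
Definition fibration1 (p : 'rV[K]_4) : 'rV[K]_2 :=
  rsubmx (lsubmx (p : 'rV_(3 + 1)) : 'rV_(1 + 2)).
Definition fibration2 (p : 'rV[K]_4) : 'rV[K]_2 :=
  lsubmx (lsubmx (p : 'rV_(3 + 1)) : 'rV_(2 + 1)).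

Definition kummer_fibration (F G : 'I_4 -> 'cV[K]_3) : qspace K :=
  @involution_quotient
    (@fiber_product (quartic_double_plane F) (quartic_double_plane G) (proj 1)
       fibration1 fibration2)
    (fun p : 'rV[K]_(4 + 4) =>
       row_mx (@sheet_swap 3 (lsubmx p)) (@sheet_swap 3 (rsubmx p))).

End Spaces.

(* Main.v *)
(* Away from y * F_1 ... F_4 = 0, the point (x, y, z, t, u) of the double octic
   goes to the class of ((x, y, z, s), (y, z, t, u / s)), where s is a square
   root of F_1(x, y, z) ... F_4(x, y, z): the other choice of s differs by the
   involution i_1 x i_2.  Scaling the second point by c = F_1 ... F_4 gives
   ((x, y, z, s), (c y, c z, c t, c u s)), which has no denominator.  The
   inverse rescales (x, y, z) by y' and (y', z', t') by y so that the last two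
   coordinates of the former match the first two of the latter, and sends the
   roots v_1, v_2 to u = (y y') ^ 2 v_1 v_2.  All open sets are dense because a
   function A + s B on a double cover s ^ 2 = D with A, B not both zero does not
   vanish identically over any nonempty open set of the base. *)
Require Import Defs.
From mathcomp Require Import all_boot all_order all_algebra.
From mathcomp Require Import boolp classical_sets mpoly ring.
From mathcomp Require Import reals complex.

Set Implicit Arguments.
Unset Strict Implicit.
Unset Printing Implicit Defensive.

Local Open Scope ring_scope.

Import GRing.Theory Num.Theory.

(** * Polynomial functions on affine space and on double covers of it *)

Section PolynomialFunctions.
Variable K : numClosedFieldType.

(** The class [C] lives on an arbitrary parameter type [T], so that one induction serves for
    one-variable polynomials along a line, for composites of polynomial maps, and for functions on a
    double cover, where [T] consists of pairs of a base point and a root. *)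
Lemma peval_ind T n (C : (T -> K) -> Prop) (p : {mpoly K[n]})
    (e : T -> 'rV[K]_n) :
  (forall c, C (fun=> c)) ->
  (forall g h, C g -> C h -> C (fun x => g x + h x)) ->
  (forall g h, C g -> C h -> C (fun x => g x * h x)) ->
  (forall i, C (fun x => e x 0 i)) -> C (fun x => peval p (e x)).
Proof.
move=> Cc Ca Cm Ce.
rewrite (_ : (fun x => _) = fun x =>
  \sum_(m <- msupp p) p@_m * \prod_i e x 0 i ^+ m i); last first.
  by apply/funext => x; rewrite /peval mevalE.
elim: (msupp p) => [|m s IH].
  by rewrite (_ : (fun x => _) = fun=> 0) //; apply/funext => x; rewrite big_nil.
rewrite (_ : (fun x => _) = fun x => p@_m * (\prod_i e x 0 i ^+ m i) +
  \sum_(m <- s) p@_m * \prod_i e x 0 i ^+ m i); last first.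
  by apply/funext => x; rewrite big_cons.
apply: Ca IH; apply: (Cm (fun=> _)) => //.
elim: (index_enum _) => [|i r IH].
  by rewrite (_ : (fun x => _) = fun=> 1) //; apply/funext => x; rewrite big_nil.
rewrite (_ : (fun x => _) = fun x => e x 0 i ^+ m i *
  \prod_(i <- r) e x 0 i ^+ m i); last first.
  by apply/funext => x; rewrite big_cons.
apply: (Cm _ _ _ IH); elim: (m i) => [|k IHk]; first exact: (Cc 1).
rewrite (_ : (fun x => _) = fun x => e x 0 i * e x 0 i ^+ k); first exact: Cm.
by apply/funext => x; rewrite exprS.
Qed.

Definition polyfun n (h : 'rV[K]_n -> K) : Prop :=
  exists p : {mpoly K[n]}, forall v, h v = peval p v.

Lemma polyfun_peval n (p : {mpoly K[n]}) : polyfun (peval p).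
Proof. by exists p. Qed.

Lemma polyfun_cst n c : polyfun (fun=> c : K) (n := n).
Proof. by exists c%:MP => v; rewrite /peval mevalC. Qed.

Lemma polyfun_coord n i : polyfun (fun v : 'rV[K]_n => v 0 i).
Proof. by exists 'X_i => v; rewrite /peval mevalXU. Qed.

Lemma polyfunD n (g h : 'rV[K]_n -> K) :
  polyfun g -> polyfun h -> polyfun (fun v => g v + h v).
Proof. by move=> [p gE] [q hE]; exists (p + q) => v; rewrite gE hE /peval mevalD. Qed.

Lemma polyfunM n (g h : 'rV[K]_n -> K) :
  polyfun g -> polyfun h -> polyfun (fun v => g v * h v).
Proof. by move=> [p gE] [q hE]; exists (p * q) => v; rewrite gE hE /peval mevalM. Qed.

Lemma polyfunX n (g : 'rV[K]_n -> K) k :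
  polyfun g -> polyfun (fun v => g v ^+ k).
Proof. by move=> [p gE]; exists (p ^+ k) => v; rewrite gE /peval rmorphXn. Qed.

Lemma polyfun_sum n I (r : seq I) (g : I -> 'rV[K]_n -> K) :
  (forall i, polyfun (g i)) -> polyfun (fun v => \sum_(i <- r) g i v).
Proof.
move=> gP; elim: r => [|i r [p IH]].
  by exists 0 => v; rewrite big_nil /peval meval0.
have [q gE] := gP i; exists (q + p) => v.
by rewrite big_cons gE IH /peval mevalD.
Qed.

Lemma polyfun_prod n I (r : seq I) (g : I -> 'rV[K]_n -> K) :
  (forall i, polyfun (g i)) -> polyfun (fun v => \prod_(i <- r) g i v).
Proof.
move=> gP; elim: r => [|i r [p IH]].
  by exists 1 => v; rewrite big_nil /peval meval1.
have [q gE] := gP i; exists (q * p) => v.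
by rewrite big_cons gE IH /peval mevalM.
Qed.

Lemma polyfun_comp m n (h : 'rV[K]_n -> K) (e : 'rV[K]_m -> 'rV[K]_n) :
  polyfun h -> (forall i, polyfun (fun v => e v 0 i)) ->
  polyfun (fun v => h (e v)).
Proof.
move=> [p hE] eP; rewrite (_ : (fun v => _) = fun v => peval p (e v)).
  by apply: peval_ind => //; [exact: polyfun_cst|exact: polyfunD|exact: polyfunM].
by apply/funext.
Qed.

(* Restriction to the line through two points where the factors do not vanish
   reduces to polynomials in one variable. *)
Lemma polyfun_nonvanishingM n (g h : 'rV[K]_n -> K) :
  polyfun g -> polyfun h -> (exists v, g v != 0) -> (exists v, h v != 0) ->
  exists v, g v * h v != 0.
Proof.
move=> [p gE] [q hE] [a ga] [b hb].
pose l (x : K) : 'rV[K]_n := a + x *: (b - a).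
have line (r : {mpoly K[n]}) : exists P : {poly K},
    forall x, peval r (l x) = P.[x].
  apply: (@peval_ind K n (fun h => exists P : {poly K}, forall x, h x = P.[x])).
  - by move=> c; exists c%:P => x; rewrite hornerC.
  - by move=> u w [P uE] [Q wE]; exists (P + Q) => x; rewrite uE wE hornerD.
  - by move=> u w [P uE] [Q wE]; exists (P * Q) => x; rewrite uE wE hornerM.
  move=> i; exists ((a 0 i)%:P + 'X * (b 0 i - a 0 i)%:P) => x.
  by rewrite !mxE !hornerE.
have [P PE] := line p; have [Q QE] := line q.
have PQ0 : P * Q != 0.
  rewrite mulf_neq0 //.
  - apply: contraNneq ga => P0; rewrite gE.
    by rewrite (_ : a = l 0) ?PE ?P0 ?horner0 // /l scale0r addr0.
  - apply: contraNneq hb => Q0; rewrite hE.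
    by rewrite (_ : b = l 1) ?QE ?Q0 ?horner0 // /l scale1r addrC subrK.
have /closed_nonrootP[x] := PQ0; rewrite rootE hornerM -PE -QE => lx.
by exists (l x); rewrite gE hE.
Qed.

Lemma polyfun_nonvanishing_prod n k (g : 'I_k -> 'rV[K]_n -> K) :
  (forall i, polyfun (g i)) -> (forall i, exists v, g i v != 0) ->
  exists v, \prod_i g i v != 0.
Proof.
move=> gP g0; elim: (index_enum _) => [|i r IH].
  by exists 0; rewrite big_nil oner_eq0.
have [v v0] := polyfun_nonvanishingM (gP i) (polyfun_prod r gP) (g0 i) IH.
by exists v; rewrite big_cons.
Qed.

(** This models the coordinate ring of the double cover s ^ 2 = D, generated by 1 and s as a module
    over the polynomials in the base coordinates. Asking for the identity only on s ^ 2 = D allows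
    every higher power of s to be reduced, while A and B are chosen once for all points and both
    roots. *)
Definition sqrt_polyfun n (D : 'rV[K]_n -> K) (h : 'rV[K]_n -> K -> K) :=
  exists A B, [/\ polyfun A, polyfun B &
    forall v s, s ^+ 2 = D v -> h v s = A v + s * B v].

Section SqrtPolyfun.
Variables (n : nat) (D : 'rV[K]_n -> K).
Hypothesis DP : polyfun D.

Lemma sqrt_polyfun_base g : polyfun g -> sqrt_polyfun D (fun v _ => g v).
Proof.
move=> gP; exists g, (fun=> 0); split=> //; first exact: polyfun_cst.
by move=> v s _; rewrite mulr0 addr0.
Qed.

Lemma sqrt_polyfun_sqrt : sqrt_polyfun D (fun _ s => s).
Proof.
exists (fun=> 0), (fun=> 1); split; [exact: polyfun_cst..|].
by move=> v s _; rewrite mulr1 add0r.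
Qed.

Lemma sqrt_polyfunD g h : sqrt_polyfun D g -> sqrt_polyfun D h ->
  sqrt_polyfun D (fun v s => g v s + h v s).
Proof.
move=> [A [B [AP BP gE]]] [A' [B' [AP' BP' hE]]].
exists (fun v => A v + A' v), (fun v => B v + B' v).
split; [exact: polyfunD..|move=> v s sD].
by rewrite gE // hE //; ring.
Qed.

Lemma sqrt_polyfunM g h : sqrt_polyfun D g -> sqrt_polyfun D h ->
  sqrt_polyfun D (fun v s => g v s * h v s).
Proof.
move=> [A [B [AP BP gE]]] [A' [B' [AP' BP' hE]]].
exists (fun v => A v * A' v + D v * (B v * B' v)),
  (fun v => A v * B' v + B v * A' v).
split; [by do !apply: polyfunD || apply: polyfunM ..|move=> v s sD].
by rewrite gE // hE // -sD; ring.
Qed.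

Lemma sqrt_polyfun_comp m (p : {mpoly K[m]}) (e : 'rV[K]_n -> K -> 'rV[K]_m) :
  (forall i, sqrt_polyfun D (fun v s => e v s 0 i)) ->
  sqrt_polyfun D (fun v s => peval p (e v s)).
Proof.
move=> eP.
apply: (@peval_ind ('rV[K]_n * K) m
  (fun h => sqrt_polyfun D (fun v s => h (v, s))) p (fun x => e x.1 x.2)) => //.
- by move=> c; apply/sqrt_polyfun_base/polyfun_cst.
- by move=> g h; apply: sqrt_polyfunD.
- by move=> g h; apply: sqrt_polyfunM.
Qed.

End SqrtPolyfun.

Lemma addr_mull_neq0 (a b s : K) : a + s * b != 0 -> (a != 0) || (b != 0).
Proof.
by apply: contraNT; rewrite negb_or !negbK => /andP[/eqP-> /eqP->];
  rewrite mulr0 addr0.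
Qed.

(** If both a + s b and a - s b vanished, their sum and difference would give 2 a = 0 and 2 s b = 0,
    hence a = b = 0 in characteristic zero with s nonzero. *)
Lemma exists_sqrt_neq0 (a b s : K) : s != 0 -> (a != 0) || (b != 0) ->
  exists2 s', s' ^+ 2 = s ^+ 2 & a + s' * b != 0.
Proof.
move=> s0 ab.
have [asb|] := eqVneq (a + s * b) 0; last by exists s.
have [amsb|] := eqVneq (a + - s * b) 0; last by exists (- s); rewrite ?sqrrN.
have a2 : 2%:R * a = 0.
  rewrite (_ : _ * _ = (a + s * b) + (a + - s * b)); last by ring.
  by rewrite asb amsb addr0.
have sb2 : 2%:R * (s * b) = 0.
  rewrite (_ : _ * _ = (a + s * b) - (a + - s * b)); last by ring.
  by rewrite asb amsb subr0.
move/eqP: a2 sb2 ab => /[swap] /eqP.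
by rewrite !mulf_eq0 pnatr_eq0 (negPf s0) /= => -> ->.
Qed.

(** This is the source of all density statements: a point of the cover where h is nonzero, possibly
    on the branch locus, is moved to one lying over M != 0. Nonvanishing of h makes A or B a nonzero
    polynomial, which is then nonzero together with M at some v; as D is nonzero there, one of the
    two roots over v keeps h nonzero. *)
Lemma sqrt_polyfun_nonvanishing n (D M : 'rV[K]_n -> K) h v0 s0 :
  polyfun M -> (exists v, M v != 0) -> (forall v, M v != 0 -> D v != 0) ->
  sqrt_polyfun D h -> s0 ^+ 2 = D v0 -> h v0 s0 != 0 ->
  exists v s, [/\ s ^+ 2 = D v, M v != 0 & h v s != 0].
Proof.
move=> MP M0 MD [A [B [AP BP hE]]] s0E; rewrite hE // => h0.
have [v Mv AB] : exists2 v, M v != 0 & (A v != 0) || (B v != 0).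
  have /orP[c0|c0] := addr_mull_neq0 h0.
    have [v] := polyfun_nonvanishingM MP AP M0 (ex_intro (fun v => A v != 0) v0 c0).
    by rewrite mulf_eq0 negb_or => /andP[Mv Av]; exists v; rewrite ?Av.
  have [v] := polyfun_nonvanishingM MP BP M0 (ex_intro (fun v => B v != 0) v0 c0).
  by rewrite mulf_eq0 negb_or => /andP[Mv Bv]; exists v; rewrite ?Bv ?orbT.
have [] := @exists_sqrt_neq0 (A v) (B v) (sqrtC (D v)) _ AB.
  by rewrite sqrtC_eq0 MD.
by move=> s; rewrite sqrtCK => sE hs; exists v, s; rewrite hE.
Qed.

End PolynomialFunctions.

(** * Open sets, density and morphisms between quotient spaces *)

Section Spaces.
Variable K : numClosedFieldType.
Local Open Scope classical_set_scope.

Lemma zariski_open_polyfun n (P : set ('rV[K]_n -> K)) :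
  (forall h, P h -> polyfun h) ->
  zariski_open [set v | exists2 h, P h & h v != 0].
Proof.
move=> Ppoly; exists [set p | P (peval p)]; apply/seteqP; split=> v /=.
  move=> [h Ph hv]; have [p hE] := Ppoly _ Ph.
  have E : h = peval p by apply/funext.
  by exists p; rewrite -E.
by move=> [p Pp pv]; exists (peval p).
Qed.

Lemma is_open_nonvanishing (X : qspace K) (h : 'rV[K]_(ambdim X) -> K) :
  polyfun h ->
  (forall x y, pts x -> h x != 0 -> pts y -> eqv x y -> h y != 0) ->
  is_open (pts (q := X) `&` [set x | h x != 0]).
Proof.
move=> hP hE; split=> [x y [xX hx] yX xy|].
  by split=> //; apply: hE xy.
exists [set v | exists2 g, [set h] g & g v != 0].
  by apply: zariski_open_polyfun => _ ->.
congr (_ `&` _); apply/seteqP; split=> v /=; first by exists h.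
by move=> [_ ->].
Qed.

Lemma is_dense_nonvanishing (X : qspace K) (U : set 'rV[K]_(ambdim X)) :
  (forall p w0, pts w0 -> peval p w0 != 0 ->
     exists w, [/\ pts w, U w & peval p w != 0]) ->
  is_dense U.
Proof.
move=> H W [_ [_ [S ->] ->]] [w0 [w0X [p Sp pw0]]].
by have [w [wX wU pw]] := H p w0 w0X pw0; exists w; split=> //; split=> //; exists p.
Qed.

(* The coordinates of [e x (sigma x)] are not polynomial in [x], but changing
   the sign of the square root does not change the class of [e x (sigma x)]:
   if an invariant function equals p / q along [e], with p = C + s D' and
   q = A + s B, then it is also C / A and D' / B. *)
Lemma sqrt_map_morphism (X Y : qspace K) U V
    (D sigma : 'rV[K]_(ambdim X) -> K)
    (e : 'rV[K]_(ambdim X) -> K -> 'rV[K]_(ambdim Y)) :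
  is_open U -> V `<=` pts (q := Y) -> (forall x, U x -> eqv x x) ->
  polyfun D -> (forall x, U x -> D x != 0) ->
  (forall i, sqrt_polyfun D (fun x s => e x s 0 i)) ->
  (forall x, sigma x ^+ 2 = D x) ->
  (forall x s, U x -> s ^+ 2 = D x -> V (e x s)) ->
  (forall x y s t, U x -> U y -> eqv x y -> s ^+ 2 = D x -> t ^+ 2 = D y ->
     eqv (e x s) (e y t)) ->
  is_morphism U V (fun x => e x (sigma x)).
Proof.
move=> [Usat [U' [SU U'E] UE]] VY Urefl DP D0 eP sigmaE eV eE.
set f := fun x => e x (sigma x).
(* The points [e x s] and [e x t] are equivalent, so the saturated set W contains both or
   neither. *)
have sW W : is_open W -> forall x s t, U x -> s ^+ 2 = D x -> t ^+ 2 = D x ->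
    W (e x s) -> W (e x t).
  move=> [Wsat _] x s t Ux sD tD Ws; apply: Wsat Ws _ _.
    exact/VY/eV.
  by apply: eE => //; apply: Urefl.
have sigma0 x : U x -> sigma x != 0.
  by move=> /D0; rewrite -sigmaE expf_eq0.
split.
- by move=> x Ux; apply: eV.
- by move=> x y Ux Uy xy; apply: eE.
- move=> W Wo WV; have [Wsat [W' [S W'E] WE]] := Wo.
  split=> [x y [Ux Wfx] Xy xy|].
    have Uy : U y by apply: Usat xy.
    split=> //; apply: Wsat Wfx _ _; first exact/VY/eV.
    exact: eE.
  (* Here U is cut out by the conditions q != 0 and W by the conditions p != 0. Since D is nonzero
     on U, p is nonzero at [e x s] for some root s exactly when A or B is nonzero at x. The products
     q A and q B thus describe the preimage by polynomials in x alone. *)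
  pose P := [set h : 'rV[K]_(ambdim X) -> K | exists q p A B,
    [/\ SU q, S p, polyfun A /\ polyfun B,
      (forall v s, s ^+ 2 = D v -> peval p (e v s) = A v + s * B v)
      & h = (fun v => peval q v * A v) \/ h = (fun v => peval q v * B v)]].
  exists [set v | exists2 h, P h & h v != 0].
    apply: zariski_open_polyfun => h [q [p [A [B [_ _ [AP BP] _]]]]].
    by move=> [] ->; apply: polyfunM => //; apply: polyfun_peval.
  apply/seteqP; split=> x.
    move=> [Ux Wfx]; move: (Ux); rewrite UE U'E => -[Xx [q Sq qx]].
    split=> //; move: Wfx; rewrite /= WE W'E => -[Yfx [p Sp]].
    have [A [B [AP BP pE]]] := sqrt_polyfun_comp DP p eP.
    rewrite pE // => /addr_mull_neq0/orP[] h0.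
    + exists (fun v => peval q v * A v); last by rewrite mulf_neq0.
      by exists q, p, A, B; split=> //; left.
    + exists (fun v => peval q v * B v); last by rewrite mulf_neq0.
      by exists q, p, A, B; split=> //; right.
  move=> [Xx [h [q [p [A [B [Sq Sp _ pE hE]]]]] hx]].
  have [qx AB] : peval q x != 0 /\ ((A x != 0) || (B x != 0)).
    case: hE hx => -> /=; rewrite mulf_eq0 negb_or => /andP[-> ->];
    by rewrite ?orbT.
  have Ux : U x by rewrite UE U'E; split=> //; exists q.
  split=> //.
  have [s sD sAB] := exists_sqrt_neq0 (sigma0 _ Ux) AB.
  rewrite sigmaE in sD.
  apply: (sW W Wo x s) => //; rewrite WE W'E; split; first exact/VY/eV.
  by exists p => //; rewrite pE.
- move=> W h Wo WV [hinv hreg]; split.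
    by move=> x y [Ux Wx] [Uy Wy] xy; apply: hinv => //; apply: eE.
  move=> v [Uv Wv]; have [p [q [qv hpq]]] := hreg _ Wv.
  (* Multiplying p / q by q / q gives h * q ^ 2 = p * q, which holds on all of W, also where q
     vanishes. It may therefore be used at both roots s and -s, even if q vanishes at one of
     them. *)
  have [A [B [[A' AE] [B' BE] qE]]] := sqrt_polyfun_comp DP (q * q) eP.
  have [C [E [[C' CE] [E' EE] pE]]] := sqrt_polyfun_comp DP (p * q) eP.
  have hAC w : U w -> W (f w) -> h (f w) * A w = C w /\ h (f w) * B w = E w.
    move=> Uw Ww.
    have H s : s ^+ 2 = D w -> h (f w) * (A w + s * B w) = C w + s * E w.
      move=> sD; rewrite -qE // -pE // /peval !mevalM -!/(peval _ _).
      have [->|q0] := eqVneq (peval q (e w s)) 0; first by rewrite !mulr0.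
      have Ws : W (e w s) by apply: (sW _ Wo _ (sigma w)).
      rewrite (_ : h (f w) = h (e w s)); last first.
        by apply: hinv => //; apply: eE => //; apply: Urefl.
      by rewrite hpq // mulrA mulfVK.
    have H1 := H _ (sigmaE w).
    have H2 : h (f w) * (A w + - sigma w * B w) = C w + - sigma w * E w.
      by apply: H; rewrite sqrrN.
    have two : (2%:R : K) != 0 by rewrite pnatr_eq0.
    split.
      apply: (mulfI two).
      transitivity (h (f w) * (A w + sigma w * B w) +
        h (f w) * (A w + - sigma w * B w)); first by ring.
      by rewrite H1 H2; ring.
    apply: (mulfI (sigma0 _ Uw)); apply: (mulfI two).
    transitivity (h (f w) * (A w + sigma w * B w) -
      h (f w) * (A w + - sigma w * B w)); first by ring.
    by rewrite H1 H2; ring.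
  have qqv : A v + sigma v * B v != 0.
    by rewrite -qE // /peval mevalM mulf_neq0.
  have /orP[Av|Bv] := addr_mull_neq0 qqv.
    exists C', A'; rewrite -AE; split=> // w [Uw Ww].
    by rewrite -AE -CE => Aw; have [<- _] := hAC w Uw Ww; rewrite /= mulfK.
  exists E', B'; rewrite -BE; split=> // w [Uw Ww].
  by rewrite -BE -EE => Bw; have [_ <-] := hAC w Uw Ww; rewrite /= mulfK.
Qed.

End Spaces.

(** * Quartic products of linear forms and homogeneous coordinates *)

Section Kummer.
Variables (K : numClosedFieldType) (F G : 'I_4 -> 'cV[K]_3).
Local Open Scope classical_set_scope.

Definition quartic (L : 'I_4 -> 'cV[K]_3) (w : 'rV[K]_3) : K :=
  \prod_i lform (L i) w.

Lemma lformZ n (l : 'cV[K]_n) c w : lform l (c *: w) = c * lform l w.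
Proof. by rewrite /lform -scalemxAl mxE. Qed.

Lemma scale_coord n c (w : 'rV[K]_n) i : (c *: w) 0 i = c * w 0 i.
Proof. by rewrite mxE. Qed.

Lemma row_coord n (w : 'I_n -> K) i : (\row_j w j) 0 i = w i.
Proof. by rewrite mxE. Qed.

Lemma row3P (v w : 'rV[K]_3) : v 0 0 = w 0 0 -> v 0 1 = w 0 1 ->
  v 0 ord_max = w 0 ord_max -> v = w.
Proof.
move=> e0 e1 e2; apply/rowP; case=> [[|[|[|//]]]] lt.
- by rewrite (_ : Ordinal lt = 0) //; apply/val_inj.
- by rewrite (_ : Ordinal lt = 1) //; apply/val_inj.
by rewrite (_ : Ordinal lt = ord_max) //; apply/val_inj.
Qed.

Lemma quarticZ L c w : quartic L (c *: w) = c ^+ 4 * quartic L w.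
Proof.
rewrite /quartic (eq_bigr _ (fun i _ => lformZ (L i) c w)).
by rewrite big_split /= prodr_const card_ord.
Qed.

Lemma polyfun_lform m n (l : 'cV[K]_n) (w : 'rV[K]_m -> 'rV[K]_n) :
  (forall i, polyfun (fun v => w v 0 i)) -> polyfun (fun v => lform l (w v)).
Proof.
move=> wP; rewrite (_ : (fun v => _) = fun v => \sum_j w v 0 j * l j 0).
  by apply: polyfun_sum => j; apply: polyfunM => //; apply: polyfun_cst.
by apply/funext => v; rewrite /lform mxE.
Qed.

Lemma polyfun_quartic m L (w : 'rV[K]_m -> 'rV[K]_3) :
  (forall i, polyfun (fun v => w v 0 i)) -> polyfun (fun v => quartic L (w v)).
Proof. by move=> wP; apply: polyfun_prod => i; apply: polyfun_lform. Qed.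

(** The class [C] is left open because this is used both for polynomial functions and for functions
    on a double cover. *)
Lemma row_mx_coord_closed T m n (C : (T -> K) -> Prop) (a : T -> 'rV[K]_m)
    (b : T -> 'rV[K]_n) :
  (forall i, C (fun x => a x 0 i)) -> (forall i, C (fun x => b x 0 i)) ->
  forall i, C (fun x => row_mx (a x) (b x) 0 i).
Proof.
move=> aC bC i; rewrite -(splitK i); case: (split i) => j /=.
  rewrite (_ : (fun x => _) = fun x => a x 0 j) //.
  by apply/funext => x; rewrite row_mxEl.
rewrite (_ : (fun x => _) = fun x => b x 0 j) //.
by apply/funext => x; rewrite row_mxEr.
Qed.

Lemma lform_neq0 n (l : 'cV[K]_n) : l != 0 -> exists v, lform l v != 0.
Proof.
move=> l0; have [j lj] : exists j, l j 0 != 0.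
  apply/existsP; apply: contraNT l0; rewrite negb_exists => /forallP l0.
  by apply/eqP/colP => j; rewrite mxE; apply/eqP; rewrite -[_ == _]negbK.
by exists (delta_mx 0 j); rewrite /lform -rowE mxE.
Qed.

Lemma double_cover_eqvP n k (L : 'I_k -> 'cV[K]_n) (p q : 'rV[K]_(n + 1)) :
  @eqv _ (double_cover L) p q <->
  exists2 c, c != 0 & lsubmx q = c *: lsubmx p /\
    rsubmx q 0 0 = c ^+ k./2 * rsubmx p 0 0.
Proof.
split=> -[c c0].
  move=> ->; exists c => //; split.
    by apply/rowP => j; rewrite !mxE /= ltn_ord.
  by rewrite !mxE /= addn0 ltnn.
move=> [ql qr]; exists c => //; apply/rowP => i; rewrite mxE.
rewrite -(splitK i); case: (split i) => j /=.
  by move/rowP/(_ j): ql; rewrite !mxE /= ltn_ord expr1.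
by move: qr; rewrite (ord1 j) !mxE /= addn0 ltnn.
Qed.

(** * Coordinates on the double octic *)

Definition xyz (p : 'rV[K]_(4 + 1)) : 'rV[K]_3 :=
  lsubmx (lsubmx p : 'rV_(3 + 1)).
Definition yzt (p : 'rV[K]_(4 + 1)) : 'rV[K]_3 :=
  rsubmx (lsubmx p : 'rV_(1 + 3)).
Definition octic_root (p : 'rV[K]_(4 + 1)) : K := rsubmx p 0 0.

Let X := double_octic (eight_forms F G).

Lemma xyz_yzt p : (xyz p 0 1 = yzt p 0 0) * (xyz p 0 ord_max = yzt p 0 1).
Proof. by split; rewrite !mxE; congr (p _ _); apply/val_inj. Qed.

Lemma polyfun_xyz i : polyfun (fun p => xyz p 0 i).
Proof.
rewrite (_ : (fun p => _) = fun p : 'rV_(4 + 1) => p 0 (lshift 1 (lshift 1 i))).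
  exact: polyfun_coord.
by apply/funext => p; rewrite !mxE.
Qed.

Lemma polyfun_yzt i : polyfun (fun p => yzt p 0 i).
Proof.
rewrite (_ : (fun p => _) =
  fun p : 'rV_(4 + 1) => p 0 (lshift 1 (rshift 1 i : 'I_4))).
  exact: polyfun_coord.
by apply/funext => p; rewrite !mxE.
Qed.

Lemma polyfun_octic_root : polyfun octic_root.
Proof.
rewrite (_ : octic_root = fun p : 'rV_(4 + 1) => p 0 (rshift 4 0)); first exact: polyfun_coord.
by apply/funext => p; rewrite /octic_root mxE.
Qed.

Lemma eight_formsE (v : 'rV[K]_4) :
  \prod_(i < 8) lform (eight_forms F G i) v =
  quartic F (lsubmx (v : 'rV_(3 + 1))) * quartic G (rsubmx (v : 'rV_(1 + 3))).
Proof.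
rewrite (@big_split_ord _ _ _ 4 4) /=; congr (_ * _); apply: eq_bigr => i _.
  rewrite /eight_forms (unsplitK (inl i)) /form_xyz /lform.
  rewrite -[v in LHS](@hsubmxK _ 1 3 1 v).
  by rewrite (@mul_row_col _ 1 3 1 1) mulmx0 addr0.
rewrite /eight_forms (unsplitK (inr i)) /form_yzt /lform.
rewrite -[v in LHS](@hsubmxK _ 1 1 3 v).
by rewrite (@mul_row_col _ 1 1 3 1) mulmx0 add0r.
Qed.

Lemma double_octicP (p : 'rV[K]_(4 + 1)) :
  @pts _ X p <->
  p != 0 /\ octic_root p ^+ 2 = quartic F (xyz p) * quartic G (yzt p).
Proof. by rewrite /X /= eight_formsE. Qed.

Lemma double_octic_eqvP (p q : 'rV[K]_(4 + 1)) :
  @eqv _ X p q <-> exists2 c, c != 0 &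
    [/\ xyz q = c *: xyz p, yzt q = c *: yzt p
      & octic_root q = c ^+ 4 * octic_root p].
Proof.
rewrite double_cover_eqvP; split=> -[c c0].
  move=> [ql qr]; exists c => //; split=> //; rewrite /xyz /yzt ql.
    by apply/rowP => i; rewrite !mxE.
  by apply/rowP => i; rewrite !mxE.
move=> [q1 q2 qr]; exists c => //; split=> //.
apply/rowP => i; have [j|j] := fintype.splitP (i : 'I_(3 + 1)) => iE.
  have iE' : i = lshift 1 j by apply/val_inj.
  by move/rowP/(_ j): q1; rewrite iE' !mxE.
have iE' : i = rshift 1 ord_max :> 'I_4.
  by apply/val_inj; rewrite /= iE (ord1 j).
by move/rowP/(_ ord_max): q2; rewrite iE' !mxE.
Qed.

(** * Coordinates on the Kummer fibration *)

Definition base1 (q : 'rV[K]_(4 + 4)) : 'rV[K]_3 :=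
  lsubmx (lsubmx q : 'rV_(3 + 1)).
Definition root1 (q : 'rV[K]_(4 + 4)) : K :=
  rsubmx (lsubmx q : 'rV_(3 + 1)) 0 0.
Definition base2 (q : 'rV[K]_(4 + 4)) : 'rV[K]_3 :=
  lsubmx (rsubmx q : 'rV_(3 + 1)).
Definition root2 (q : 'rV[K]_(4 + 4)) : K :=
  rsubmx (rsubmx q : 'rV_(3 + 1)) 0 0.

Definition kummer_point (w1 : 'rV[K]_3) (v1 : K) (w2 : 'rV[K]_3) (v2 : K) :
    'rV[K]_(4 + 4) :=
  row_mx (row_mx w1 v1%:M : 'rV_(3 + 1)) (row_mx w2 v2%:M : 'rV_(3 + 1)).

Lemma kummer_pointE w1 v1 w2 v2 (q := kummer_point w1 v1 w2 v2) :
  (base1 q = w1) * (root1 q = v1) * (base2 q = w2) * (root2 q = v2).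
Proof.
rewrite /base1 /root1 /base2 /root2 /q /kummer_point.
by rewrite !(row_mxKl, row_mxKr) !mxE.
Qed.

Lemma kummer_pointK q :
  kummer_point (base1 q) (root1 q) (base2 q) (root2 q) = q.
Proof.
have scalarE (A : 'rV[K]_1) : (A 0 0)%:M = A.
  by apply/rowP => i; rewrite ord1 mxE.
by rewrite /kummer_point !scalarE !hsubmxK.
Qed.

Let Y := kummer_fibration F G.

(** Since (y, z) is nonzero and c != 0, the pair (y', z') is nonzero too, and so are both points of
    the weighted projective spaces; this accounts for the nonvanishing conditions in the definition
    of the fibre product. *)
Lemma kummer_fibrationP (q : 'rV[K]_(4 + 4)) :
  @pts _ Y q <->
  [/\ root1 q ^+ 2 = quartic F (base1 q), root2 q ^+ 2 = quartic G (base2 q),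
      (base1 q 0 1 != 0) || (base1 q 0 ord_max != 0)
    & exists2 c, c != 0 & base2 q 0 0 = c * base1 q 0 1 /\
        base2 q 0 1 = c * base1 q 0 ord_max].
Proof.
have f1 : fibration1 (lsubmx q) = \row_(j < 2) base1 q 0 (rshift 1 j).
  by apply/rowP => j; rewrite !mxE.
have f2 : fibration2 (rsubmx q) = \row_(j < 2) base2 q 0 (lshift 1 j).
  by apply/rowP => j; rewrite !mxE.
have i1 : rshift 1 (0 : 'I_2) = 1 :> 'I_3 by apply/val_inj.
have i2 : rshift 1 (1 : 'I_2) = ord_max :> 'I_3 by apply/val_inj.
have i0 : lshift 1 (0 : 'I_2) = 0 :> 'I_3 by apply/val_inj.
have i1' : lshift 1 (1 : 'I_2) = 1 :> 'I_3 by apply/val_inj.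
have ord2 (j : 'I_2) : j = 0 \/ j = 1.
  by case: j => [[|[|//]]] lt; [left|right]; apply/val_inj.
have fib1 : (fibration1 (lsubmx q) != 0) =
    (base1 q 0 1 != 0) || (base1 q 0 ord_max != 0).
  rewrite f1 -negb_and; congr (~~ _).
  apply/eqP/andP; [move=> /rowP H|move=> [/eqP H1 /eqP H2]].
    have E j : base1 q 0 (rshift 1 j) = 0.
      by have := H j; rewrite row_coord [RHS]mxE.
    by rewrite -i1 -i2 !E eqxx.
  by apply/rowP => j; case: (ord2 j) => ->; rewrite [LHS]mxE [RHS]mxE ?i1 ?i2.
have fibE c : (fibration2 (rsubmx q) =
      \row_i (c ^+ 1 * fibration1 (lsubmx q) 0 i)) <->
    base2 q 0 0 = c * base1 q 0 1 /\ base2 q 0 1 = c * base1 q 0 ord_max.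
  rewrite f1 f2; split=> [/rowP H|[H1 H2]].
    have := H 0; have := H 1; rewrite !row_coord i1 i2 i0 i1' expr1.
    by move=> -> ->.
  by apply/rowP => j; case: (ord2 j) => ->; rewrite !row_coord expr1 ?i0 ?i1 ?i2 ?i1'.
split.
  move=> [[[_ q1] [_ q2]] [f10 _ [c c0 /fibE fE]]].
  by split=> //; [rewrite -fib1|exists c].
move=> [q1 q2 b0 [c c0 fE]].
have f10 : fibration1 (lsubmx q) != 0 by rewrite fib1.
have f20 : fibration2 (rsubmx q) != 0.
  apply: contraNneq f10 => f20; apply/eqP/rowP => j.
  move/fibE/rowP/(_ j): fE; rewrite f20 row_coord [LHS]mxE expr1 => /esym/eqP.
  by rewrite mulf_eq0 (negPf c0) [RHS]mxE => /eqP.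
split; last by split=> //; exists c => //; apply/fibE.
split; split=> //.
  apply: contraNneq f10 => a0; rewrite /fibration1 a0.
  by apply/eqP/rowP => j; rewrite !mxE.
apply: contraNneq f20 => a0; rewrite /fibration2 a0.
by apply/eqP/rowP => j; rewrite !mxE.
Qed.

(** The sign e records whether i_1 x i_2 has been applied. It is common to both roots, whereas the
    two homogeneous scalings c1 and c2 are independent. *)
Lemma kummer_fibration_eqvP (p q : 'rV[K]_(4 + 4)) :
  @eqv _ Y p q <-> exists e c1 c2, [/\ e ^+ 2 = 1, c1 != 0 /\ c2 != 0,
    base1 q = c1 *: base1 p /\ root1 q = e * c1 ^+ 2 * root1 p
    & base2 q = c2 *: base2 p /\ root2 q = e * c2 ^+ 2 * root2 p].
Proof.
pose swap := row_mx (sheet_swap (lsubmx p : 'rV_(3 + 1)))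
  (sheet_swap (rsubmx p : 'rV_(3 + 1))) : 'rV_(4 + 4).
have oppE (a : 'rV[K]_1) : (- a) 0 0 = - a 0 0 by rewrite mxE.
have [b1 r1] : base1 swap = base1 p /\ root1 swap = - root1 p.
  by rewrite /base1 /root1 !row_mxKl row_mxKr oppE.
have [b2 r2] : base2 swap = base2 p /\ root2 swap = - root2 p.
  by rewrite /base2 /root2 !row_mxKr row_mxKl oppE.
have E (p' : 'rV[K]_(4 + 4)) :
    (@eqv _ (quartic_double_plane F) (lsubmx p') (lsubmx q) /\
     @eqv _ (quartic_double_plane G) (rsubmx p') (rsubmx q)) <->
    exists c1 c2, [/\ c1 != 0 /\ c2 != 0,
      base1 q = c1 *: base1 p' /\ root1 q = c1 ^+ 2 * root1 p'
      & base2 q = c2 *: base2 p' /\ root2 q = c2 ^+ 2 * root2 p'].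
  split=> [[/double_cover_eqvP[c1 c10 H1] /double_cover_eqvP[c2 c20 H2]]|].
    by exists c1, c2.
  by move=> [c1 [c2 [[c10 c20] H1 H2]]]; split; apply/double_cover_eqvP;
    [exists c1|exists c2].
rewrite /Y /= -/swap !E b1 r1 b2 r2; split.
  move=> [] [c1 [c2 [c0 [H1 H1'] [H2 H2']]]].
    by exists 1, c1, c2; rewrite expr1n !mul1r.
  exists (-1), c1, c2; rewrite sqrrN expr1n; move: H1' H2'.
  by rewrite !mulNr !mul1r !mulrN.
move=> [e [c1 [c2 [/eqP e2 c0 [H1 H1'] [H2 H2']]]]].
move: e2 H1' H2'; rewrite sqrf_eq1 => /orP[]/eqP->; rewrite ?mulNr ?mul1r => H1' H2';
  [left|right]; exists c1, c2; first by [].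
by rewrite !mulrN.
Qed.

(** * The two rational maps *)

(** On these sets y, and y' for V, can serve as rescaling factors, and F_1 ... F_4 is nonzero, so
    that its two square roots are distinct and multiplication by it is a legitimate scaling. *)
Let U := @pts _ X `&`
  [set p | xyz p 0 1 * quartic F (xyz p) != 0].
Let V := @pts _ Y `&`
  [set q | base1 q 0 1 * (base2 q 0 0 * root1 q) != 0].

Lemma polyfun_base1 i : polyfun (fun q : 'rV[K]_(4 + 4) => base1 q 0 i).
Proof.
rewrite (_ : (fun q => _) = fun q : 'rV_(4 + 4) => q 0 (lshift 4 (lshift 1 i))).
  exact: polyfun_coord.
by apply/funext => p; rewrite !mxE.
Qed.

Lemma polyfun_base2 i : polyfun (fun q : 'rV[K]_(4 + 4) => base2 q 0 i).
Proof.
rewrite (_ : (fun q => _) = fun q : 'rV_(4 + 4) => q 0 (rshift 4 (lshift 1 i))).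
  exact: polyfun_coord.
by apply/funext => p; rewrite !mxE.
Qed.

Lemma polyfun_root1 : polyfun root1.
Proof.
rewrite (_ : root1 = fun q : 'rV_(4 + 4) => q 0 (lshift 4 (rshift 3 0))).
  exact: polyfun_coord.
by apply/funext => p; rewrite /root1 !mxE.
Qed.

Lemma polyfun_root2 : polyfun root2.
Proof.
rewrite (_ : root2 = fun q : 'rV_(4 + 4) => q 0 (rshift 4 (rshift 3 0))).
  exact: polyfun_coord.
by apply/funext => p; rewrite /root2 !mxE.
Qed.

Lemma polyfun_quartic_xyz : polyfun (fun p => quartic F (xyz p)).
Proof. by apply: polyfun_quartic polyfun_xyz. Qed.

Lemma is_open_octic_domain : @is_open _ X U.
Proof.
apply: is_open_nonvanishing.
  by apply: polyfunM (polyfun_xyz 1) polyfun_quartic_xyz.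
move=> p q _ Fp _ /double_octic_eqvP[c c0 [-> _ _]].
move: Fp; rewrite mulf_eq0 negb_or quarticZ scale_coord => /andP[y0 F0].
by do ![apply: mulf_neq0]; rewrite ?expf_neq0.
Qed.

Lemma is_open_kummer_domain : @is_open _ Y V.
Proof.
apply: is_open_nonvanishing.
  apply: polyfunM (polyfun_base1 1) (polyfunM (polyfun_base2 0) polyfun_root1).
move=> p q _ Fp _ /kummer_fibration_eqvP[e [c1 [c2 [e2 [c10 c20]]]]].
move=> [-> ->] [-> _].
have e0 : e != 0 by apply/eqP => e0; move/eqP: e2; rewrite e0 expr0n eq_sym oner_eq0.
move: Fp; rewrite !scale_coord !mulf_eq0 !negb_or => /and3P[-> -> ->].
by rewrite c10 c20 e0.
Qed.

Definition octic_to_kummer (p : 'rV[K]_(4 + 1)) (s : K) : 'rV[K]_(4 + 4) :=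
  kummer_point (xyz p) s (quartic F (xyz p) *: yzt p)
    (quartic F (xyz p) * octic_root p * s).

Definition kummer_to_octic (q : 'rV[K]_(4 + 4)) : 'rV[K]_(4 + 1) :=
  let y1 := base1 q 0 1 in let y2 := base2 q 0 0 in
  row_mx (row_mx (y2 *: base1 q) (y1 * base2 q 0 ord_max)%:M : 'rV_(3 + 1))
    ((y1 * y2) ^+ 2 * (root1 q * root2 q))%:M.

(** The definition takes z from the first point only. The fibre condition y' = c y, z' = c z gives
    y' z = y z', so the same coordinate is also the rescaled z'. *)
Lemma kummer_to_octicE q : @pts _ Y q ->
  [/\ xyz (kummer_to_octic q) = base2 q 0 0 *: base1 q,
      yzt (kummer_to_octic q) = base1 q 0 1 *: base2 q
    & octic_root (kummer_to_octic q) =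
      (base1 q 0 1 * base2 q 0 0) ^+ 2 * (root1 q * root2 q)].
Proof.
move=> /kummer_fibrationP[_ _ _ [c c0 [b0 b1]]].
have x : xyz (kummer_to_octic q) = base2 q 0 0 *: base1 q.
  by rewrite /xyz /kummer_to_octic !row_mxKl.
split=> //; last by rewrite /octic_root /kummer_to_octic row_mxKr mxE.
apply: row3P.
- by rewrite -(xyz_yzt _).1 x !scale_coord mulrC.
- by rewrite -(xyz_yzt _).2 x !scale_coord b0 b1; ring.
rewrite scale_coord /yzt /kummer_to_octic row_mxKl mxE.
have -> : rshift 1 ord_max = rshift 3 0 :> 'I_4 by apply/val_inj.
by rewrite (@row_mxEr _ 1 3 1) mxE.
Qed.

Lemma octic_to_kummer_domain p s :
  U p -> s ^+ 2 = quartic F (xyz p) -> V (octic_to_kummer p s).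
Proof.
rewrite /U /V => -[/double_octicP[p0 pE] /=].
rewrite mulf_eq0 negb_or => /andP[y0 F0] sE.
have s0 : s != 0 by rewrite -sE expf_eq0 in F0.
split; last first.
  rewrite /= /octic_to_kummer !kummer_pointE scale_coord -(xyz_yzt p).1.
  by rewrite !mulf_eq0 !negb_or y0 F0 s0.
apply/kummer_fibrationP; rewrite /octic_to_kummer !kummer_pointE y0; split=> //.
  (* With F = F_1 ... F_4 and G = F_5 ... F_8, (F u s) ^ 2 = F ^ 2 * (F G) * F = F ^ 4 G, the value
     of the quartic G at F times (y, z, t). *)
  by rewrite quarticZ !exprMn sE pE; ring.
by exists (quartic F (xyz p)) => //; rewrite !scale_coord !(xyz_yzt p).
Qed.

Lemma kummer_to_octic_domain q : V q -> U (kummer_to_octic q).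
Proof.
rewrite /U /V => -[Yq /=]; rewrite !mulf_eq0 !negb_or => /and3P[y1 y2 r1].
have [xE yE rE] := kummer_to_octicE Yq.
have /kummer_fibrationP[q1 q2 _ _] := Yq.
have xy0 : xyz (kummer_to_octic q) 0 1 != 0.
  by rewrite xE scale_coord mulf_neq0.
split; last first.
  by rewrite /= xy0 xE quarticZ -q1 mulf_neq0 ?expf_neq0.
apply/double_octicP; split.
  by apply: contraNneq xy0 => ->; rewrite !mxE.
by rewrite xE yE rE !quarticZ -q1 -q2; ring.
Qed.

Lemma octic_to_kummer_eqv p q s t : U p -> U q -> @eqv _ X p q ->
  s ^+ 2 = quartic F (xyz p) -> t ^+ 2 = quartic F (xyz q) ->
  @eqv _ Y (octic_to_kummer p s) (octic_to_kummer q t).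
Proof.
move=> [_ /=]; rewrite mulf_eq0 negb_or => /andP[_ F0] _.
move=> /double_octic_eqvP[c c0 [xE yE rE]] sE.
rewrite xE quarticZ -sE => tE.
have s0 : s != 0 by rewrite -sE expf_eq0 in F0.
(* From t ^ 2 = c ^ 4 s ^ 2, the quotient t / (c ^ 2 s) is a sign. The second point scales by c ^ 5:
   c from (y, z, t) and c ^ 4 from the quartic factor. *)
apply/kummer_fibration_eqvP; exists (t / (c ^+ 2 * s)), c, (c ^+ 5).
rewrite /octic_to_kummer !kummer_pointE xE yE rE quarticZ -sE.
split; first by rewrite expr_div_n tE; field; rewrite c0 s0.
- by rewrite expf_neq0.
- by split=> //; field; rewrite c0 s0.
split; first by rewrite !scalerA; congr (_ *: _); ring.
by field; rewrite c0 s0.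
Qed.

Lemma kummer_to_octic_eqv p q : V p -> V q -> @eqv _ Y p q ->
  @eqv _ X (kummer_to_octic p) (kummer_to_octic q).
Proof.
move=> [Yp _] [Yq _] /kummer_fibration_eqvP.
move=> [e [c1 [c2 [e2 [c10 c20] [b1 r1] [b2 r2]]]]].
have [xp yp rp] := kummer_to_octicE Yp.
have [xq yq rq] := kummer_to_octicE Yq.
apply/double_octic_eqvP; exists (c1 * c2); first by rewrite mulf_neq0.
rewrite xp xq yp yq rp rq b1 r1 b2 r2 !scale_coord.
split; [by rewrite !scalerA; congr (_ *: _); ring..|].
(* The product of the roots picks up the sign e twice, which is why the map descends to the quotient
   by i_1 x i_2. *)
transitivity (e ^+ 2 * ((c1 * c2) ^+ 4 *
  ((base1 p 0 1 * base2 p 0 0) ^+ 2 * (root1 p * root2 p)))); first by ring.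
by rewrite e2 mul1r.
Qed.

Lemma octic_to_kummerK p s : U p -> s ^+ 2 = quartic F (xyz p) ->
  @eqv _ X (kummer_to_octic (octic_to_kummer p s)) p.
Proof.
move=> Up sE; have [Yq _] := octic_to_kummer_domain Up sE.
move: Up => [_ /=]; rewrite mulf_eq0 negb_or => /andP[y0 F0].
have [xE yE rE] := kummer_to_octicE Yq.
have s0 : s != 0 by rewrite -sE expf_eq0 in F0.
(* The composite multiplies (x, y, z, t) by the second coordinate y' = F_1 ... F_4 y = s ^ 2 y of
   its intermediate point. *)
apply/double_octic_eqvP; exists (s ^+ 2 * xyz p 0 1)^-1.
  by rewrite invr_neq0 // mulf_neq0 // expf_neq0.
rewrite xE yE rE /octic_to_kummer !kummer_pointE scale_coord.
rewrite -(xyz_yzt p).1 -sE !scalerA.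
by split; [rewrite mulVf ?scale1r // mulf_neq0 // expf_neq0
  |rewrite (_ : _ * _ = 1) ?scale1r //; field; rewrite y0 s0
  |field; rewrite y0 s0].
Qed.

Lemma kummer_to_octicK q s :
  V q -> s ^+ 2 = quartic F (xyz (kummer_to_octic q)) ->
  @eqv _ Y (octic_to_kummer (kummer_to_octic q) s) q.
Proof.
move=> [Yq /=]; rewrite !mulf_eq0 !negb_or => /and3P[y1 y2 r1].
have [xE yE rE] := kummer_to_octicE Yq.
have /kummer_fibrationP[q1 q2 _ _] := Yq.
rewrite xE quarticZ -q1 => sE.
have s0 : s != 0.
  have: s ^+ 2 != 0 by rewrite sE mulf_neq0 ?expf_neq0.
  by rewrite expf_eq0.
apply/kummer_fibration_eqvP.
set y := base1 q 0 1 in y1 *; set y' := base2 q 0 0 in y2 sE *.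
(* The composite scales the first point by y' and the second by y times the quartic at y' (x, y, z),
   that is by y y' ^ 4 v_1 ^ 2. The chosen root s of y' ^ 4 v_1 ^ 2 agrees with y' ^ 2 v_1 up to the
   sign given here. *)
exists (y' ^+ 2 * root1 q / s), y'^-1, (y * y' ^+ 4 * root1 q ^+ 2)^-1.
rewrite /octic_to_kummer !kummer_pointE xE yE rE quarticZ -q1 -/y -/y' !scalerA.
have c0 : y * y' ^+ 4 * root1 q ^+ 2 != 0.
  by rewrite !mulf_neq0 ?expf_neq0.
split.
- by rewrite expr_div_n sE; field; rewrite y2 r1.
- by rewrite !invr_neq0.
- by split; [rewrite mulVf ?scale1r|field; rewrite y2 s0].
split; first by rewrite (_ : _ * _ = 1) ?scale1r //; field; rewrite r1 y1 y2.
by field; rewrite s0 r1 y1 y2.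
Qed.

(** * The two maps are morphisms *)

Lemma scalar_coord_closed T (C : (T -> K) -> Prop) (h : T -> K) :
  C h -> forall i : 'I_1, C (fun x => (h x)%:M 0 i).
Proof.
move=> Ch i; rewrite (_ : (fun x => _) = h) //.
by apply/funext => x; rewrite ord1 mxE.
Qed.

Lemma kummer_point_coord_closed T (C : (T -> K) -> Prop) (w1 w2 : T -> 'rV[K]_3) v1 v2 :
  (forall i, C (fun x => w1 x 0 i)) -> C v1 ->
  (forall i, C (fun x => w2 x 0 i)) -> C v2 ->
  forall i, C (fun x => kummer_point (w1 x) (v1 x) (w2 x) (v2 x) 0 i).
Proof.
move=> C1 C2 C3 C4.
have H1 := row_mx_coord_closed C1 (scalar_coord_closed C2).
have H2 := row_mx_coord_closed C3 (scalar_coord_closed C4).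
exact: row_mx_coord_closed H1 H2.
Qed.

Lemma scale_coord_closed T (C : (T -> K) -> Prop) n (c : T -> K) (w : T -> 'rV[K]_n) :
  (forall g h, C g -> C h -> C (fun x => g x * h x)) ->
  C c -> (forall i, C (fun x => w x 0 i)) ->
  forall i, C (fun x => (c x *: w x) 0 i).
Proof.
move=> CM Cc Cw i; rewrite (_ : (fun x => _) = fun x => c x * w x 0 i).
  exact: CM.
by apply/funext => x; rewrite mxE.
Qed.

Lemma octic_to_kummer_morphism :
  @is_morphism _ X Y U V (fun p => octic_to_kummer p (sqrtC (quartic F (xyz p)))).
Proof.
pose D p := quartic F (xyz p).
have DP : polyfun D by exact: polyfun_quartic_xyz.
apply: (@sqrt_map_morphism K X Y U V D (fun p => sqrtC (D p)) octic_to_kummer).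
- exact: is_open_octic_domain.
- by move=> ? [].
- move=> p _; apply/double_octic_eqvP; exists 1; first exact: oner_neq0.
  by rewrite !scale1r expr1n mul1r.
- exact: DP.
- by move=> p [_ /=]; rewrite mulf_eq0 negb_or => /andP[].
- pose C (h : 'rV[K]_(4 + 1) * K -> K) := sqrt_polyfun D (fun v s => h (v, s)).
  have CM g h : C g -> C h -> C (fun x => g x * h x) by apply: sqrt_polyfunM.
  have base h : polyfun h -> C (fun x => h x.1) by apply: sqrt_polyfun_base.
  apply: (@kummer_point_coord_closed _ C (fun x => xyz x.1)
    (fun x => D x.1 *: yzt x.1) (fun x => x.2) (fun x => D x.1 * octic_root x.1 * x.2)).
  + by move=> i; apply: base (polyfun_xyz i).
  + exact: sqrt_polyfun_sqrt.
  + apply: scale_coord_closed => //; first exact: base DP.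
    by move=> i; apply: base (polyfun_yzt i).
  + apply: (CM _ _ _ (sqrt_polyfun_sqrt D)).
    by apply: CM; apply: base => //; apply: polyfun_octic_root.
- by move=> p; rewrite sqrtCK.
- exact: octic_to_kummer_domain.
- exact: octic_to_kummer_eqv.
Qed.

(** A polynomial map is the degenerate case D = sigma = 1 of [sqrt_map_morphism], with [e] ignoring
    the root. *)
Lemma kummer_to_octic_morphism : @is_morphism _ Y X V U kummer_to_octic.
Proof.
apply: (@sqrt_map_morphism K Y X V U (fun=> 1) (fun=> 1)
  (fun q _ => kummer_to_octic q)).
- exact: is_open_kummer_domain.
- by move=> ? [].
- move=> p _; apply/kummer_fibration_eqvP; exists 1, 1, 1.
  by rewrite !expr1n !scale1r !mul1r !oner_neq0.
- exact: polyfun_cst.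
- by move=> *; apply: oner_neq0.
- move=> i; apply: sqrt_polyfun_base.
  have y1P := polyfun_base1 1; have y2P := polyfun_base2 0.
  have c1 := scale_coord_closed (C := @polyfun K _) (@polyfunM K _) y2P polyfun_base1.
  have c2 := scalar_coord_closed (polyfunM y1P (polyfun_base2 ord_max)).
  have c3 := scalar_coord_closed (polyfunM (polyfunX 2 (polyfunM y1P y2P))
    (polyfunM polyfun_root1 polyfun_root2)).
  exact: row_mx_coord_closed (row_mx_coord_closed c1 c2) c3 i.
- by move=> *; rewrite expr1n.
- by move=> q s Vq _; apply: kummer_to_octic_domain.
- by move=> p q s t Vp Vq pq _ _; apply: kummer_to_octic_eqv.
Qed.

(** * Density of the two domains and the birational equivalence *)

Hypotheses (F0 : forall i, F i != 0) (G0 : forall i, G i != 0).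

Lemma quartic_nonvanishing L : (forall i, L i != 0) -> exists w, quartic L w != 0.
Proof.
move=> L0; apply: polyfun_nonvanishing_prod => i; last exact: lform_neq0.
by apply: polyfun_lform; apply: polyfun_coord.
Qed.

Lemma is_dense_octic_domain : @is_dense _ X U.
Proof.
apply: is_dense_nonvanishing => P p0 /double_octicP[_ p0E] Pp0.
pose xyz' (a : 'rV[K]_4) : 'rV[K]_3 := lsubmx (a : 'rV_(3 + 1)).
pose yzt' (a : 'rV[K]_4) : 'rV[K]_3 := rsubmx (a : 'rV_(1 + 3)).
pose H a := quartic F (xyz' a) * quartic G (yzt' a).
pose e (a : 'rV[K]_4) (u : K) : 'rV[K]_(4 + 1) := row_mx a u%:M.
have eE a u : (xyz (e a u) = xyz' a) * (yzt (e a u) = yzt' a) *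
    (octic_root (e a u) = u).
  by rewrite /xyz /yzt /octic_root !row_mxKl row_mxKr mxE.
have xyzP i : polyfun (fun a => xyz' a 0 i).
  rewrite (_ : (fun a => _) = fun a : 'rV_4 => a 0 (lshift 1 i)).
    exact: polyfun_coord.
  by apply/funext => a; rewrite mxE.
have yztP i : polyfun (fun a => yzt' a 0 i).
  rewrite (_ : (fun a => _) = fun a : 'rV_4 => a 0 (rshift 1 i : 'I_4)).
    exact: polyfun_coord.
  by apply/funext => a; rewrite mxE.
have FP : polyfun (fun a => quartic F (xyz' a)) by exact: polyfun_quartic.
have GP : polyfun (fun a => quartic G (yzt' a)) by exact: polyfun_quartic.
have HP : polyfun H by exact: polyfunM FP GP.
have PE : sqrt_polyfun H (fun a u => peval P (e a u)).
  apply: sqrt_polyfun_comp => //.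
  pose C (h : 'rV[K]_4 * K -> K) := sqrt_polyfun H (fun v s => h (v, s)).
  apply: (@row_mx_coord_closed _ _ _ C fst (fun x => x.2%:M)).
    by move=> i; apply: sqrt_polyfun_base; apply: polyfun_coord.
  by apply: scalar_coord_closed; apply: sqrt_polyfun_sqrt.
have p0E' : p0 = e (lsubmx p0) (octic_root p0).
  rewrite -[LHS]hsubmxK; congr row_mx; apply/rowP => i.
  by rewrite ord1 [RHS]mxE mulr1n.
(* The factor H contains the branch quartic of G as well, so that the double cover u ^ 2 = H is
   unramified over M != 0. *)
pose M a := xyz' a 0 1 * H a.
have MP : polyfun M by exact: polyfunM (xyzP 1) HP.
have M0 : exists a, M a != 0.
  apply: polyfun_nonvanishingM => //.
    by exists (const_mx 1); rewrite !mxE oner_eq0.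
  have [w1 Fw1] := quartic_nonvanishing F0.
  have [w2 Gw2] := quartic_nonvanishing G0.
  apply: polyfun_nonvanishingM => //.
    by exists (row_mx w1 0 : 'rV_(3 + 1)); rewrite /xyz' row_mxKl.
  by exists (row_mx 0 w2 : 'rV_(1 + 3)); rewrite /yzt' row_mxKr.
rewrite p0E' in Pp0.
have MH a : M a != 0 -> H a != 0 by rewrite /M mulf_eq0 negb_or => /andP[].
have [|a [u [uE Ma Pu]]] := sqrt_polyfun_nonvanishing MP M0 MH PE _ Pp0.
  by rewrite p0E.
move: Ma; rewrite /M mulf_eq0 negb_or => /andP[y0 Ha].
exists (e a u).
have Xe : @pts _ X (e a u).
  apply/double_octicP; rewrite !eE; split=> //.
  by apply: contraNneq y0 => e0; rewrite -(eE a u).1.1 e0 !mxE.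
split=> //; split=> //=; rewrite !eE mulf_neq0 //.
by move: Ha; rewrite mulf_eq0 negb_or => /andP[].
Qed.

(** The affine points form a tower of two double covers over the space of b = (x, y, z, c, t), where
    (y', z') = c (y, z): first v_1 ^ 2 = F_1 ... F_4 over b, then v_2 ^ 2 = F_5 ... F_8 over (b,
    v_1). Nonvanishing of P is pushed down the tower one root at a time, and the roots are then
    chosen going back up. *)
Lemma is_dense_kummer_domain : @is_dense _ Y V.
Proof.
apply: is_dense_nonvanishing => P q0 /kummer_fibrationP[q01 q02 _].
move=> [c0 c00 [b0 b1]] Pq0.
pose w1 (b : 'rV[K]_(3 + 2)) : 'rV[K]_3 := lsubmx b.
pose c (b : 'rV[K]_(3 + 2)) : K := rsubmx b 0 0.
pose t (b : 'rV[K]_(3 + 2)) : K := rsubmx b 0 1.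
pose w2 b : 'rV[K]_3 := \row_j
  if j == 0 then c b * w1 b 0 1 else if j == 1 then c b * w1 b 0 ord_max else t b.
pose mk (w : 'rV[K]_3) (c t : K) : 'rV[K]_(3 + 2) :=
  row_mx w (\row_j if j == 0 then c else t).
have mkE w c' t' : (w1 (mk w c' t') = w) * (c (mk w c' t') = c') *
    (t (mk w c' t') = t').
  by rewrite /w1 /c /t /mk row_mxKl row_mxKr !row_coord.
have w2E b : [/\ w2 b 0 0 = c b * w1 b 0 1, w2 b 0 1 = c b * w1 b 0 ord_max
    & w2 b 0 ord_max = t b].
  by split; rewrite /w2 row_coord.
pose e2 (d : 'rV[K]_(5 + 1)) (v2 : K) : 'rV[K]_(4 + 4) :=
  kummer_point (w1 (lsubmx d)) (rsubmx d 0 0) (w2 (lsubmx d)) v2.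
pose D2 (d : 'rV[K]_(5 + 1)) := quartic G (w2 (lsubmx d)).
pose D1 b := quartic F (w1 b).
(* The factor y c keeps y and y' = c y nonzero; the two quartics keep both roots away from zero. *)
pose M b := w1 b 0 1 * c b * (D1 b * quartic G (w2 b)).
pose e1 (b : 'rV[K]_5) (v1 : K) : 'rV[K]_(5 + 1) := row_mx b v1%:M.
have e1E b v1 : (lsubmx (e1 b v1) = b) * (rsubmx (e1 b v1) 0 0 = v1).
  by rewrite row_mxKl row_mxKr mxE.
have w1P i : polyfun (fun b => w1 b 0 i).
  rewrite (_ : (fun b => _) = fun b : 'rV_(3 + 2) => b 0 (lshift 2 i)).
    exact: polyfun_coord.
  by apply/funext => b; rewrite mxE.
have cP : polyfun c.
  rewrite (_ : c = fun b : 'rV_(3 + 2) => b 0 (rshift 3 0)).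
    exact: polyfun_coord.
  by apply/funext => b; rewrite /c mxE.
have tP : polyfun t.
  rewrite (_ : t = fun b : 'rV_(3 + 2) => b 0 (rshift 3 1)).
    exact: polyfun_coord.
  by apply/funext => b; rewrite /t mxE.
have w2P i : polyfun (fun b => w2 b 0 i).
  rewrite (_ : (fun b => _) = fun b => if i == 0 then c b * w1 b 0 1
    else if i == 1 then c b * w1 b 0 ord_max else t b); last first.
    by apply/funext => b; rewrite row_coord.
  case: (i == 0); first exact: polyfunM cP (w1P 1).
  by case: (i == 1); first exact: polyfunM cP (w1P ord_max).
have D1P : polyfun D1 by exact: polyfun_quartic.
have GP : polyfun (fun b => quartic G (w2 b)) by exact: polyfun_quartic.
have baseP : forall i, polyfun (fun d : 'rV[K]_(5 + 1) => (lsubmx d : 'rV_5) 0 i).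
  move=> i; rewrite (_ : (fun d => _) = fun d : 'rV_(5 + 1) => d 0 (lshift 1 i)).
    exact: polyfun_coord.
  by apply/funext => d; rewrite mxE.
have D2P : polyfun D2 by exact: polyfun_comp GP baseP.
have MP : polyfun M.
  exact: polyfunM (polyfunM (w1P 1) cP) (polyfunM D1P GP).
have M0 : exists b, M b != 0.
  apply: polyfun_nonvanishingM.
  - exact: polyfunM (w1P 1) cP.
  - exact: polyfunM D1P GP.
  - by exists (mk (const_mx 1) 1 0); rewrite !mkE mxE mulr1 oner_eq0.
  have [a Fa] := quartic_nonvanishing F0.
  have [b Gb] := quartic_nonvanishing G0.
  apply: polyfun_nonvanishingM => //.
    by exists (mk a 0 0); rewrite /D1 mkE.
  (* With c = 1 the second point is (y, z, t), so y, z, t are read off from b; the value of x is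
     arbitrary. *)
  exists (mk (\row_j if j == 1 then b 0 0 else b 0 1) 1 (b 0 ord_max)).
  rewrite (_ : w2 _ = b) //; have [v0 v1 v2] := w2E (mk
    (\row_j if j == 1 then b 0 0 else b 0 1) 1 (b 0 ord_max)).
  by apply: row3P; rewrite ?v0 ?v1 ?v2 !mkE ?row_coord ?mul1r.
have MD1 b : M b != 0 -> D1 b != 0.
  by rewrite /M !mulf_eq0 !negb_or => /andP[_ /andP[]].
have [A [B [AP BP PE]]] : sqrt_polyfun D2 (fun d v2 => peval P (e2 d v2)).
  apply: sqrt_polyfun_comp => //.
  pose C (h : 'rV[K]_(5 + 1) * K -> K) := sqrt_polyfun D2 (fun v s => h (v, s)).
  have base h : polyfun h -> C (fun x => h x.1) by apply: sqrt_polyfun_base.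
  have rP : polyfun (fun d : 'rV[K]_(5 + 1) => rsubmx d 0 0).
    rewrite (_ : (fun d => _) = fun d : 'rV_(5 + 1) => d 0 (rshift 5 0)).
      exact: polyfun_coord.
    by apply/funext => d; rewrite mxE.
  have Cw1 i : C (fun x => w1 (lsubmx x.1) 0 i).
    exact: base (polyfun_comp (w1P i) baseP).
  have Cw2 i : C (fun x => w2 (lsubmx x.1) 0 i).
    exact: base (polyfun_comp (w2P i) baseP).
  exact: (@kummer_point_coord_closed _ C (fun x => w1 (lsubmx x.1))
    (fun x => w2 (lsubmx x.1)) (fun x => rsubmx x.1 0 0) snd Cw1 (base _ rP)
    Cw2 (sqrt_polyfun_sqrt D2)).
have sqrtE A' : polyfun A' -> sqrt_polyfun D1 (fun b v1 => A' (e1 b v1)).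
  move=> [p A'E].
  rewrite (_ : (fun b v1 => _) = fun b v1 => peval p (e1 b v1)); last first.
    by apply/funext => b; apply/funext => v1.
  apply: sqrt_polyfun_comp => //.
  pose C (h : 'rV[K]_5 * K -> K) := sqrt_polyfun D1 (fun v s => h (v, s)).
  have Cs : C snd by apply: sqrt_polyfun_sqrt.
  have Cb i : C (fun x => x.1 0 i) by apply: sqrt_polyfun_base; apply: polyfun_coord.
  exact: row_mx_coord_closed Cb (scalar_coord_closed Cs).
pose b0' := mk (base1 q0) c0 (base2 q0 0 ord_max).
have w2b0 : w2 b0' = base2 q0.
  by have [v0 v1 v2] := w2E b0'; apply: row3P; rewrite ?v0 ?v1 ?v2 !mkE.
have q0E : q0 = e2 (e1 b0' (root1 q0)) (root2 q0).
  by rewrite /e2 !e1E w2b0 mkE kummer_pointK.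
have q02' : root2 q0 ^+ 2 = D2 (e1 b0' (root1 q0)).
  by rewrite /D2 e1E w2b0.
rewrite q0E PE // in Pq0.
(* Q is whichever of A and B is nonzero at the starting point. It is a polynomial in (b, v_1), hence
   of the form required over the first double cover. *)
have [Q [QP Q0 QAB]] : exists Q, [/\ polyfun Q, Q (e1 b0' (root1 q0)) != 0 &
    forall d, Q d != 0 -> (A d != 0) || (B d != 0)].
  have /orP[h0|h0] := addr_mull_neq0 Pq0.
    by exists A; split=> // d ->.
  by exists B; split=> // d ->; rewrite orbT.
have [|b [v1 [v1E Mb Qb]]] := sqrt_polyfun_nonvanishing MP M0 MD1 (sqrtE Q QP) _ Q0.
  by rewrite /D1 mkE.
have D1b := MD1 b Mb.
move: Mb; rewrite /M mulf_eq0 negb_or mulf_eq0 negb_or => /andP[/andP[y0 cb0]].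
rewrite mulf_eq0 negb_or => /andP[_ Gb].
(* Once b and v_1 are fixed, it remains to choose the sign of v_2 so that P stays nonzero. *)
have [] := @exists_sqrt_neq0 _ _ _ (sqrtC (D2 (e1 b v1))) _ (QAB _ Qb).
  by rewrite sqrtC_eq0 /D2 e1E.
move=> v2; rewrite sqrtCK => v2E Pv; exists (e2 (e1 b v1) v2).
have eE : (base1 (e2 (e1 b v1) v2) = w1 b) * (root1 (e2 (e1 b v1) v2) = v1) *
    (base2 (e2 (e1 b v1) v2) = w2 b) * (root2 (e2 (e1 b v1) v2) = v2).
  by rewrite /e2 !kummer_pointE !e1E.
have v10 : v1 != 0 by move: D1b; rewrite -v1E expf_eq0.
have [w20 w21 _] := w2E b.
have Yq : @pts _ Y (e2 (e1 b v1) v2).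
  apply/kummer_fibrationP; rewrite !eE y0; split=> //.
    by rewrite v2E /D2 e1E.
  by exists (c b).
split=> //; last by rewrite PE.
by split=> //=; rewrite !eE w20 !mulf_neq0.
Qed.

Lemma birational_octic_kummer : birational X Y.
Proof.
exists U, V, (fun p => octic_to_kummer p (sqrtC (quartic F (xyz p)))),
  kummer_to_octic; split.
- by split; [exact: is_open_octic_domain|exact: is_dense_octic_domain].
- by split; [exact: is_open_kummer_domain|exact: is_dense_kummer_domain].
- exact: octic_to_kummer_morphism.
- exact: kummer_to_octic_morphism.
split; first by move=> p Up; apply: octic_to_kummerK; rewrite ?sqrtCK.
by move=> q Vq; apply: kummer_to_octicK; rewrite ?sqrtCK.
Qed.

End Kummer.

(* F 0, ..., F 3 are F_1, ..., F_4 (coefficients of x, y, z) and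
   G 0, ..., G 3 are F_5, ..., F_8 (coefficients of y, z, t). *)
Theorem theorem4p1 (R : realType) (F G : 'I_4 -> 'cV[R[i]]_3)
  (hoct : octic_arrangement (eight_forms F G))
  (hF : forall v : 'rV[R[i]]_4, v != 0 ->
     (forall i, lform (form_xyz (F i)) v = 0) <->
     @eqv _ (proj _ 3) (delta_mx 0 (inord 3)) v)
  (hG : forall v : 'rV[R[i]]_4, v != 0 ->
     (forall i, lform (form_yzt (G i)) v = 0) <->
     @eqv _ (proj _ 3) (delta_mx 0 (inord 0)) v) :
  birational (double_octic (eight_forms F G)) (kummer_fibration F G).
Proof.
have [l0 _ _ _] := hoct.
apply: birational_octic_kummer => i.
  have := l0 (lshift 4 i : 'I_(4 + 4)); rewrite /eight_forms (unsplitK (inl i)).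
  by apply: contraNneq => ->; rewrite /form_xyz col_mx0.
have := l0 (rshift 4 i : 'I_(4 + 4)); rewrite /eight_forms (unsplitK (inr i)).
by apply: contraNneq => ->; rewrite /form_yzt col_mx0.
Qed.
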